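(* Let $\mathbb{R}^*$ be the field of hyperreal numbers. In the hyperreal plane $\mathbb{R}^*\times\mathbb{R}^*$, let $\angle ACB$ be an angle with vertex $C$, where $A, C, B$ are not collinear. Let $l$ and $p$ be two distinct parallel lines, neither passing through $C$, that intersect both arms of the angle: $l$ meets the ray from $C$ through $A$ at $P$ and the ray from $C$ through $B$ at $Q$, while $p$ meets the ray from $C$ through $A$ at $P'$ and the ray from $C$ through $B$ at $Q'$, with $P$ lying between $C$ and $P'$ and $Q$ lying between $C$ and $Q'$. Let $a, b, c, d\in\mathbb{R}^*_+$ be the lengths of the segments $CP$, $PP'$, $CQ$, $QQ'$, respectively. Then $$\frac{a}{b}=\frac{c}{d}.$$
   Context: The hyperreal field is the ultrapower $\mathbb{R}^*=\mathbb{R}^{\mathbb{N}}/\mathcal{U}$, where $\mathcal{U}$ is a non-principal ultrafilter on $\mathbb{N}$; it is a non-Archimedean ordered field with operations and order defined by representatives modulo $\mathcal{U}$, and contains $\mathbb{R}$ via classes of constant sequences. $\mathbb{R}^*_+$ is the set of positive hyperreals. The plane $\mathbb{R}^*\times\mathbb{R}^*$ is the Cartesian plane over the ordered field $\mathbb{R}^*$: lines are solution sets of linear equations $ux+vy+w=0$ with $u,v,w\in\mathbb{R}^*$ and $(u,v)\neq(0,0)$; rays and betweenness are defined via the order of $\mathbb{R}^*$; parallel lines are lines with no common point; and the length of the segment joining $(x_1,y_1)$ and $(x_2,y_2)$ is $\sqrt{(x_1-x_2)^2+(y_1-y_2)^2}\in\mathbb{R}^*$ (square roots of non-negative elements exist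 in $\mathbb{R}^*$). *)

(* Defs.v *)
From HB Require Import structures.
From mathcomp Require Import all_boot all_order all_algebra.
From mathcomp Require Import generic_quotient.
From mathcomp Require Import boolp classical_sets filter reals.

Set Implicit Arguments.
Unset Strict Implicit.
Unset Printing Implicit Defensive.

Import Order.TTheory GRing.Theory Num.Theory.
Local Open Scope ring_scope.
Local Open Scope classical_set_scope.
Local Open Scope quotient_scope.

Definition nonprincipal (T : Type) (U : set_system T) : Prop :=
  forall x : T, U <> principal_filter x.

Definition hyper_eq (R : realType) (U : set_system nat) : rel (nat -> R) :=
  fun u v => `[< \forall n \near U, u n = v n >].

Lemma hyper_eq_equiv (R : realType) (U : set_system nat) :
  UltraFilter U -> equiv_class_of (@hyper_eq R U).
Proof.
move=> HU; split=> [u|u v|v u w].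
- by apply/asboolP; near=> n.
- by apply/asboolP/asboolP => H; near=> n; apply/esym; near: n.
- move=> /asboolP uv /asboolP vw; apply/asboolP; near=> n.
  by transitivity (v n); near: n.
Unshelve. all: by end_near. Qed.

Canonical hyper_equiv (R : realType) (U : set_system nat)
  (HU : UltraFilter U) := EquivRelPack (hyper_eq_equiv R HU).

Definition hyperreal (R : realType) (U : set_system nat)
  (HU : UltraFilter U) : Type := {eq_quot (hyper_equiv R HU)}.

HB.instance Definition _ (R : realType) (U : set_system nat)
  (HU : UltraFilter U) := Choice.on (hyperreal R HU).
HB.instance Definition _ (R : realType) (U : set_system nat)
  (HU : UltraFilter U) := EqQuotient.on (hyperreal R HU).

Definition hyper_class (R : realType) (U : set_system nat)
  (HU : UltraFilter U) (u : nat -> R) : hyperreal R HU :=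
  \pi_(hyperreal R HU) u.

Lemma hyper_classP (R : realType) (U : set_system nat) (HU : UltraFilter U)
    (u v : nat -> R) :
  hyper_class HU u = hyper_class HU v <-> \forall n \near U, u n = v n.
Proof.
split=> [/eqP|H]; first by rewrite [_ == _]piE => /asboolP.
by apply/eqP; rewrite [_ == _]piE; apply/asboolP.
Qed.

Lemma hyper_reprK (R : realType) (U : set_system nat) (HU : UltraFilter U)
  (x : hyperreal R HU) : hyper_class HU (repr x) = x.
Proof. exact: reprK. Qed.

Lemma hyper_repr (R : realType) (U : set_system nat) (HU : UltraFilter U)
  (u : nat -> R) : \forall n \near U, repr (hyper_class HU u) n = u n.
Proof. by apply/hyper_classP; exact: hyper_reprK. Qed.

Lemma hyper_ind (R : realType) (U : set_system nat) (HU : UltraFilter U)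
    (P : hyperreal R HU -> Prop) :
  (forall u, P (hyper_class HU u)) -> forall x, P x.
Proof. by move=> H x; rewrite -(hyper_reprK x). Qed.

Definition hyper_add (R : realType) (U : set_system nat) (HU : UltraFilter U)
  (x y : hyperreal R HU) := hyper_class HU (fun n => repr x n + repr y n).
Definition hyper_opp (R : realType) (U : set_system nat) (HU : UltraFilter U)
  (x : hyperreal R HU) := hyper_class HU (fun n => - repr x n).
Definition hyper_mul (R : realType) (U : set_system nat) (HU : UltraFilter U)
  (x y : hyperreal R HU) := hyper_class HU (fun n => repr x n * repr y n).
Definition hyper_inv (R : realType) (U : set_system nat) (HU : UltraFilter U)
  (x : hyperreal R HU) := hyper_class HU (fun n => (repr x n)^-1).
Definition hyper_norm (R : realType) (U : set_system nat) (HU : UltraFilter U)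
  (x : hyperreal R HU) := hyper_class HU (fun n => `|repr x n|).
Definition hyper_cst (R : realType) (U : set_system nat) (HU : UltraFilter U)
  (r : R) := hyper_class HU (fun=> r).
Definition hyper_le (R : realType) (U : set_system nat) (HU : UltraFilter U) :
  rel (hyperreal R HU) :=
  fun x y => `[< \forall n \near U, repr x n <= repr y n >].
Definition hyper_lt (R : realType) (U : set_system nat) (HU : UltraFilter U) :
  rel (hyperreal R HU) :=
  fun x y => `[< \forall n \near U, repr x n < repr y n >].

Lemma hyper_addE (R : realType) (U : set_system nat) (HU : UltraFilter U)
    (u v : nat -> R) :
  hyper_add (hyper_class HU u) (hyper_class HU v) =
  hyper_class HU (fun n => u n + v n).
Proof.
by apply/hyper_classP; near=> n; congr (_ + _); near: n; exact: hyper_repr.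
Unshelve. all: by end_near. Qed.

Lemma hyper_oppE (R : realType) (U : set_system nat) (HU : UltraFilter U)
    (u : nat -> R) :
  hyper_opp (hyper_class HU u) = hyper_class HU (fun n => - u n).
Proof.
by apply/hyper_classP; near=> n; congr (- _); near: n; exact: hyper_repr.
Unshelve. all: by end_near. Qed.

Lemma hyper_mulE (R : realType) (U : set_system nat) (HU : UltraFilter U)
    (u v : nat -> R) :
  hyper_mul (hyper_class HU u) (hyper_class HU v) =
  hyper_class HU (fun n => u n * v n).
Proof.
by apply/hyper_classP; near=> n; congr (_ * _); near: n; exact: hyper_repr.
Unshelve. all: by end_near. Qed.

Lemma hyper_invE (R : realType) (U : set_system nat) (HU : UltraFilter U)
    (u : nat -> R) :
  hyper_inv (hyper_class HU u) = hyper_class HU (fun n => (u n)^-1).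
Proof.
by apply/hyper_classP; near=> n; congr (_^-1); near: n; exact: hyper_repr.
Unshelve. all: by end_near. Qed.

Lemma hyper_normE (R : realType) (U : set_system nat) (HU : UltraFilter U)
    (u : nat -> R) :
  hyper_norm (hyper_class HU u) = hyper_class HU (fun n => `|u n|).
Proof.
by apply/hyper_classP; near=> n; congr (`|_|); near: n; exact: hyper_repr.
Unshelve. all: by end_near. Qed.

Lemma hyper_leP (R : realType) (U : set_system nat) (HU : UltraFilter U)
    (u v : nat -> R) :
  reflect (\forall n \near U, u n <= v n)
          (hyper_le (hyper_class HU u) (hyper_class HU v)).
Proof.
have Hu := hyper_repr HU u; have Hv := hyper_repr HU v.
apply: (iffP (asboolP _)) => H; near=> n.
  have <- : repr (hyper_class HU u) n = u n by near: n.
  have <- : repr (hyper_class HU v) n = v n by near: n.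
  by near: n.
have -> : repr (hyper_class HU u) n = u n by near: n.
have -> : repr (hyper_class HU v) n = v n by near: n.
by near: n.
Unshelve. all: by end_near. Qed.

Lemma hyper_ltP (R : realType) (U : set_system nat) (HU : UltraFilter U)
    (u v : nat -> R) :
  reflect (\forall n \near U, u n < v n)
          (hyper_lt (hyper_class HU u) (hyper_class HU v)).
Proof.
have Hu := hyper_repr HU u; have Hv := hyper_repr HU v.
apply: (iffP (asboolP _)) => H; near=> n.
  have <- : repr (hyper_class HU u) n = u n by near: n.
  have <- : repr (hyper_class HU v) n = v n by near: n.
  by near: n.
have -> : repr (hyper_class HU u) n = u n by near: n.
have -> : repr (hyper_class HU v) n = v n by near: n.
by near: n.
Unshelve. all: by end_near. Qed.

Lemma hyper_addA (R : realType) (U : set_system nat) (HU : UltraFilter U) :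
  associative (@hyper_add R U HU).
Proof.
elim/hyper_ind=> u; elim/hyper_ind=> v; elim/hyper_ind=> w.
by rewrite !hyper_addE; congr hyper_class; apply/funext => n; rewrite addrA.
Qed.

Lemma hyper_addC (R : realType) (U : set_system nat) (HU : UltraFilter U) :
  commutative (@hyper_add R U HU).
Proof.
elim/hyper_ind=> u; elim/hyper_ind=> v.
by rewrite !hyper_addE; congr hyper_class; apply/funext => n; rewrite addrC.
Qed.

Lemma hyper_add0 (R : realType) (U : set_system nat) (HU : UltraFilter U) :
  left_id (hyper_cst HU 0) (@hyper_add R U HU).
Proof.
elim/hyper_ind=> u.
by rewrite !hyper_addE; congr hyper_class; apply/funext => n; rewrite add0r.
Qed.

Lemma hyper_addN (R : realType) (U : set_system nat) (HU : UltraFilter U) :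
  left_inverse (hyper_cst HU 0) (@hyper_opp R U HU) (@hyper_add R U HU).
Proof.
elim/hyper_ind=> u; rewrite hyper_oppE.
by rewrite !hyper_addE; congr hyper_class; apply/funext => n; rewrite addNr.
Qed.

HB.instance Definition _ (R : realType) (U : set_system nat)
    (HU : UltraFilter U) :=
  GRing.isZmodule.Build (hyperreal R HU) (@hyper_addA R U HU)
    (@hyper_addC R U HU) (@hyper_add0 R U HU) (@hyper_addN R U HU).

Lemma hyper_mulA (R : realType) (U : set_system nat) (HU : UltraFilter U) :
  associative (@hyper_mul R U HU).
Proof.
elim/hyper_ind=> u; elim/hyper_ind=> v; elim/hyper_ind=> w.
by rewrite !hyper_mulE; congr hyper_class; apply/funext => n; rewrite mulrA.
Qed.

Lemma hyper_mulC (R : realType) (U : set_system nat) (HU : UltraFilter U) :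
  commutative (@hyper_mul R U HU).
Proof.
elim/hyper_ind=> u; elim/hyper_ind=> v.
by rewrite !hyper_mulE; congr hyper_class; apply/funext => n; rewrite mulrC.
Qed.

Lemma hyper_mul1 (R : realType) (U : set_system nat) (HU : UltraFilter U) :
  left_id (hyper_cst HU 1) (@hyper_mul R U HU).
Proof.
elim/hyper_ind=> u.
by rewrite !hyper_mulE; congr hyper_class; apply/funext => n; rewrite mul1r.
Qed.

Lemma hyper_mulD (R : realType) (U : set_system nat) (HU : UltraFilter U) :
  left_distributive (@hyper_mul R U HU) (@hyper_add R U HU).
Proof.
elim/hyper_ind=> u; elim/hyper_ind=> v; elim/hyper_ind=> w.
rewrite !(hyper_mulE, hyper_addE); congr hyper_class; apply/funext => n.
by rewrite mulrDl.
Qed.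

Lemma hyper_1neq0 (R : realType) (U : set_system nat) (HU : UltraFilter U) :
  hyper_cst HU (1 : R) != hyper_cst HU 0.
Proof.
apply/eqP => /hyper_classP /filter_ex [n /eqP]; by rewrite oner_eq0.
Qed.

HB.instance Definition _ (R : realType) (U : set_system nat)
    (HU : UltraFilter U) :=
  GRing.Zmodule_isComNzRing.Build (hyperreal R HU) (@hyper_mulA R U HU)
    (@hyper_mulC R U HU) (@hyper_mul1 R U HU) (@hyper_mulD R U HU)
    (hyper_1neq0 R HU).

Lemma hyper_mulV (R : realType) (U : set_system nat) (HU : UltraFilter U)
  (x : hyperreal R HU) : x != 0 -> hyper_inv x * x = 1.
Proof.
elim/hyper_ind: x => u /eqP u0; rewrite hyper_invE.
rewrite [LHS]hyper_mulE; apply/hyper_classP.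
have [H|H] := in_ultra_setVsetC [set n | u n = 0] HU.
  by case: u0; apply/hyper_classP.
by near=> n; rewrite mulVf//; apply/eqP; near: n; exact: H.
Unshelve. all: by end_near. Qed.

Lemma hyper_inv0 (R : realType) (U : set_system nat) (HU : UltraFilter U) :
  hyper_inv (0 : hyperreal R HU) = 0.
Proof.
by rewrite [LHS]hyper_invE; congr hyper_class; apply/funext => n; rewrite invr0.
Qed.

HB.instance Definition _ (R : realType) (U : set_system nat)
    (HU : UltraFilter U) :=
  GRing.ComNzRing_isField.Build (hyperreal R HU) (@hyper_mulV R U HU)
    (hyper_inv0 R HU).

Lemma hyper_le0_add (R : realType) (U : set_system nat) (HU : UltraFilter U)
  (x y : hyperreal R HU) :
  hyper_le 0 x -> hyper_le 0 y -> hyper_le 0 (x + y).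
Proof.
elim/hyper_ind: x => u; elim/hyper_ind: y => v.
move=> /hyper_leP Hu /hyper_leP Hv; rewrite [_ + _]hyper_addE.
by apply/hyper_leP; near=> n; apply: addr_ge0; near: n.
Unshelve. all: by end_near. Qed.

Lemma hyper_le0_mul (R : realType) (U : set_system nat) (HU : UltraFilter U)
  (x y : hyperreal R HU) :
  hyper_le 0 x -> hyper_le 0 y -> hyper_le 0 (x * y).
Proof.
elim/hyper_ind: x => u; elim/hyper_ind: y => v.
move=> /hyper_leP Hu /hyper_leP Hv; rewrite [_ * _]hyper_mulE.
by apply/hyper_leP; near=> n; apply: mulr_ge0; near: n.
Unshelve. all: by end_near. Qed.

Lemma hyper_le0_anti (R : realType) (U : set_system nat) (HU : UltraFilter U)
  (x : hyperreal R HU) : hyper_le 0 x -> hyper_le x 0 -> x = 0.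
Proof.
elim/hyper_ind: x => u /hyper_leP u0 /hyper_leP u1; apply/hyper_classP.
by near=> n; apply/eqP; rewrite eq_le; apply/andP; split; near: n.
Unshelve. all: by end_near. Qed.

Lemma hyper_sub_ge0 (R : realType) (U : set_system nat) (HU : UltraFilter U)
  (x y : hyperreal R HU) : hyper_le 0 (y - x) = hyper_le x y.
Proof.
elim/hyper_ind: x => u; elim/hyper_ind: y => v.
rewrite [- _]hyper_oppE [_ + _]hyper_addE.
apply/hyper_leP/hyper_leP => H; near=> n.
  by rewrite -subr_ge0; near: n.
by rewrite subr_ge0; near: n.
Unshelve. all: by end_near. Qed.

Lemma hyper_le0_total (R : realType) (U : set_system nat) (HU : UltraFilter U)
  (x : hyperreal R HU) : hyper_le 0 x || hyper_le x 0.
Proof.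
elim/hyper_ind: x => u.
have [H|H] := in_ultra_setVsetC [set n | 0 <= u n] HU; apply/orP.
  by left; apply/hyper_leP.
right; apply/hyper_leP; near=> n; apply/ltW; rewrite ltNge; apply/negP.
by near: n; exact: H.
Unshelve. all: by end_near. Qed.

Lemma hyper_normN (R : realType) (U : set_system nat) (HU : UltraFilter U)
  (x : hyperreal R HU) : hyper_norm (- x) = hyper_norm x.
Proof.
elim/hyper_ind: x => u; rewrite [- _]hyper_oppE !hyper_normE.
by congr hyper_class; apply/funext => n; rewrite normrN.
Qed.

Lemma hyper_ge0_norm (R : realType) (U : set_system nat) (HU : UltraFilter U)
  (x : hyperreal R HU) : hyper_le 0 x -> hyper_norm x = x.
Proof.
elim/hyper_ind: x => u /hyper_leP H; rewrite hyper_normE; apply/hyper_classP.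
by near=> n; rewrite ger0_norm//; near: n.
Unshelve. all: by end_near. Qed.

Lemma hyper_lt_def (R : realType) (U : set_system nat) (HU : UltraFilter U)
  (x y : hyperreal R HU) : hyper_lt x y = (y != x) && hyper_le x y.
Proof.
elim/hyper_ind: x => u; elim/hyper_ind: y => v.
apply/hyper_ltP/andP => [H|[/eqP vu /hyper_leP H]].
  split; last by apply/hyper_leP; near=> n; apply/ltW; near: n.
  apply/eqP => /hyper_classP E.
  have /filter_ex [n []] : \forall n \near U, v n = u n /\ u n < v n.
    by near=> n; split; near: n.
  by move=> ->; rewrite ltxx.
have [E|E] := in_ultra_setVsetC [set n | v n = u n] HU.
  by case: vu; apply/hyper_classP.
near=> n; rewrite lt_def; apply/andP; split; last by near: n.
by apply/eqP; near: n; exact: E.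
Unshelve. all: by end_near. Qed.

HB.instance Definition _ (R : realType) (U : set_system nat)
    (HU : UltraFilter U) :=
  Num.IntegralDomain_isLeReal.Build (hyperreal R HU) (@hyper_le0_add R U HU)
    (@hyper_le0_mul R U HU) (@hyper_le0_anti R U HU) (@hyper_sub_ge0 R U HU)
    (@hyper_le0_total R U HU) (@hyper_normN R U HU) (@hyper_ge0_norm R U HU)
    (@hyper_lt_def R U HU).

Lemma hyper_horner (R : realType) (U : set_system nat) (HU : UltraFilter U)
  (p : {poly hyperreal R HU}) (u : nat -> R) :
  p.[hyper_class HU u] =
  hyper_class HU
    (fun n => (\poly_(i < size p) repr p`_i n).[u n]).
Proof.
rewrite horner_coef.
transitivity (hyper_class HU (fun n => \sum_(i < size p) repr p`_i n * u n ^+ i));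
  last by congr hyper_class; apply/funext => n; rewrite horner_poly.
elim: (size p) => [|k IH].
  rewrite big_ord0; congr hyper_class.
  by apply/funext => n; rewrite big_ord0.
have HX j : hyper_class HU u ^+ j = hyper_class HU (fun n => u n ^+ j).
  elim: j => [|j IHj]; first by rewrite expr0.
  rewrite exprS IHj [LHS]hyper_mulE; congr hyper_class.
  by apply/funext => n; rewrite exprS.
rewrite big_ord_recr /= IH HX -{1}[p`_k]hyper_reprK.
rewrite [_ * _]hyper_mulE [LHS]hyper_addE; congr hyper_class.
by apply/funext => n; rewrite big_ord_recr.
Qed.

(* Square roots of nonnegative hyperreals, i.e. Num.sqrt, come with the
   real closed field structure. *)
Lemma hyper_real_closed (R : realType) (U : set_system nat)
  (HU : UltraFilter U) : Num.real_closed_axiom (hyperreal R HU).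
Proof.
move=> p x y; elim/hyper_ind: x => u; elim/hyper_ind: y => v.
move=> /hyper_leP uv; rewrite !hyper_horner.
move=> /andP[/hyper_leP pu /hyper_leP pv].
pose q n := \poly_(i < size p) repr p`_i n.
have Hq n : exists z, u n <= v n -> (q n).[u n] <= 0 -> 0 <= (q n).[v n] ->
    [/\ u n <= z, z <= v n & (q n).[z] = 0].
  case: (pselect [/\ u n <= v n, (q n).[u n] <= 0 & 0 <= (q n).[v n]]).
    move=> [h1 h2 h3].
    have [|z /andP[z1 z2] /eqP z3] := @poly_ivt _ (q n) (u n) (v n) h1.
      by rewrite h2 h3.
    by exists z.
  by move=> h; exists 0 => h1 h2 h3; case: h.
have [w Hw] := boolp.choice Hq.
have W : \forall n \near U, [/\ u n <= w n, w n <= v n & (q n).[w n] = 0].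
  by near=> n; apply: Hw; near: n.
exists (hyper_class HU w).
  by apply/andP; split; apply/hyper_leP; near=> n;
    suff [] : [/\ u n <= w n, w n <= v n & (q n).[w n] = 0] by []; near: n.
apply/eqP; rewrite hyper_horner; apply/hyper_classP; near=> n.
by suff [] : [/\ u n <= w n, w n <= v n & (q n).[w n] = 0] by []; near: n.
Unshelve. all: by end_near. Qed.

HB.instance Definition _ (R : realType) (U : set_system nat)
    (HU : UltraFilter U) :=
  Num.RealField_isClosed.Build (hyperreal R HU) (@hyper_real_closed R U HU).

Definition is_line (F : rcfType) (l : set (F * F)) : Prop :=
  exists u v w : F, (u, v) <> (0, 0) /\
    l = [set X | u * X.1 + v * X.2 + w = 0].

Definition collinear (F : rcfType) (X Y Z : F * F) : Prop :=
  exists l : set (F * F), [/\ is_line l, l X, l Y & l Z].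

Definition parallel (F : rcfType) (l m : set (F * F)) : Prop :=
  [/\ is_line l, is_line m & l `&` m = set0].

(* Degenerates to {C} when A = C. *)
Definition ray (F : rcfType) (C A : F * F) : set (F * F) :=
  [set X | exists t : F, 0 <= t /\
    X = (C.1 + t * (A.1 - C.1), C.2 + t * (A.2 - C.2))].

(* X <> Z rules out the degenerate solution X = Y = Z. *)
Definition between (F : rcfType) (X Y Z : F * F) : Prop :=
  X <> Z /\ exists t : F, [/\ 0 < t, t < 1 &
    Y = (X.1 + t * (Z.1 - X.1), X.2 + t * (Z.2 - X.2))].

Definition seg_length (F : rcfType) (X Y : F * F) : F :=
  Num.sqrt ((X.1 - Y.1) ^+ 2 + (X.2 - Y.2) ^+ 2).

(* Main.v *)
Require Import Defs.
From mathcomp Require Import all_boot all_order all_algebra.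
From mathcomp Require Import boolp classical_sets filter reals.
From mathcomp Require Import ring.

Set Implicit Arguments.
Unset Strict Implicit.
Unset Printing Implicit Defensive.

Import Order.TTheory GRing.Theory Num.Theory.
Local Open Scope ring_scope.
Local Open Scope classical_set_scope.

(** The argument takes place in the plane over an arbitrary real closed field.
    Two parallel lines are level sets of one and the same linear form
    [phi (x, y) = u * x + v * y] ([parallel_common_normal]).  Write
    [P = C + t (P' - C)] and [Q = C + s (Q' - C)].  Since [phi] takes one value
    at [P] and [Q], and one value at [P'] and [Q'],
    [t (phi P' - phi C) = phi P - phi C = phi Q - phi C = s (phi P' - phi C)],
    and [phi P' <> phi C] because [C] is not on the second line; hence [t = s]
    ([parallel_same_fraction]).  Lengths scale with the parameter, so a point
    at parameter [t] cuts its segment in the ratio [t / (1 - t)]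
    ([seg_length_ratio]), which is then the same on both arms. *)

(** If the two normals were independent, Cramer's rule would produce a common
    point; so they are proportional, and rescaling the second equation gives
    both lines the same normal. *)
Lemma parallel_common_normal (F : rcfType) (l p : set (F * F)) :
  parallel l p -> exists u v w w' : F,
    l = [set X | u * X.1 + v * X.2 + w = 0] /\
    p = [set X | u * X.1 + v * X.2 + w' = 0].
Proof.
move=> [[u [v [w [uv0 ->]]]] [u' [v' [w' [uv0' ->]]]] lp0].
have det0 : u * v' - u' * v = 0.
  apply/eqP; apply: contraT => det_neq0.
  suff : set0 ((v * w' - v' * w) / (u * v' - u' * v),
               (w * u' - w' * u) / (u * v' - u' * v)) by [].
  by rewrite -lp0; split => /=; field.
have norm2_neq0 : u ^+ 2 + v ^+ 2 != 0.
  apply/eqP => /eqP; rewrite paddr_eq0 ?sqr_ge0// !sqrf_eq0.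
  by move=> /andP[/eqP u0 /eqP v0]; apply: uv0; rewrite u0 v0.
(* The orthogonal projection of (u', v') onto (u, v) is k (u, v). *)
pose k := (u * u' + v * v') / (u ^+ 2 + v ^+ 2).
have u'E : u' = k * u.
  apply: (mulIf norm2_neq0); rewrite /k mulrAC divfK//.
  by apply/eqP; rewrite -subr_eq0; apply/eqP;
    transitivity (- v * (u * v' - u' * v)); [ring|rewrite det0 mulr0].
have v'E : v' = k * v.
  apply: (mulIf norm2_neq0); rewrite /k mulrAC divfK//.
  by apply/eqP; rewrite -subr_eq0; apply/eqP;
    transitivity (u * (u * v' - u' * v)); [ring|rewrite det0 mulr0].
have k_neq0 : k != 0.
  by apply/eqP => k0; apply: uv0'; rewrite u'E v'E k0 !mul0r.
exists u, v, w, (w' / k); split=> //; apply/seteqP; split=> X /= XE.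
  by apply: (mulfI k_neq0); rewrite mulr0 -XE u'E v'E; field.
by rewrite -[RHS](mulr0 k) -XE u'E v'E; field.
Qed.

Lemma parallel_same_fraction (F : rcfType) (l p : set (F * F))
    (C P Q P' Q' : F * F) (t s : F) :
  parallel l p -> ~ p C -> l P -> l Q -> p P' -> p Q' ->
  P = (C.1 + t * (P'.1 - C.1), C.2 + t * (P'.2 - C.2)) ->
  Q = (C.1 + s * (Q'.1 - C.1), C.2 + s * (Q'.2 - C.2)) ->
  t = s.
Proof.
move=> /parallel_common_normal[u [v [w [w' [-> ->]]]]] /= /eqP pC.
move=> lP lQ pP' pQ' PE QE; move: lP lQ; rewrite PE QE /= => lP lQ.
(* The left-hand side of the second equation, evaluated at C, is
   phi C - phi P', which is also phi C - phi Q'. *)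
apply: (mulIf pC); apply/eqP; rewrite -subr_eq0; apply/eqP.
rewrite [LHS](_ : _ =
    (u * (C.1 + s * (Q'.1 - C.1)) + v * (C.2 + s * (Q'.2 - C.2)) + w)
  - (u * (C.1 + t * (P'.1 - C.1)) + v * (C.2 + t * (P'.2 - C.2)) + w)
  + t * (u * P'.1 + v * P'.2 + w') - s * (u * Q'.1 + v * Q'.2 + w')); last by ring.
by rewrite lP lQ pP' pQ' !mulr0 !subr0 addr0.
Qed.

Lemma seg_length_gt0 (F : rcfType) (X Y : F * F) :
  X <> Y -> 0 < seg_length X Y.
Proof.
case: X Y => [x1 x2] [y1 y2] XY; rewrite sqrtr_gt0 lt0r addr_ge0 ?sqr_ge0//.
rewrite paddr_eq0 ?sqr_ge0// !sqrf_eq0 !subr_eq0 andbT.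
by apply/negP => /andP[/eqP /= x1E /eqP /= x2E]; apply: XY; rewrite x1E x2E.
Qed.

Lemma seg_length_ratio (F : rcfType) (X Y Z : F * F) (t : F) :
  X <> Z -> 0 < t -> t < 1 ->
  Y = (X.1 + t * (Z.1 - X.1), X.2 + t * (Z.2 - X.2)) ->
  seg_length X Y / seg_length Y Z = t / (1 - t).
Proof.
move=> /seg_length_gt0 XZ t0 t1 ->.
have scale (r e : F) : 0 <= r -> e = r ^+ 2 * ((X.1 - Z.1) ^+ 2 + (X.2 - Z.2) ^+ 2) ->
    Num.sqrt e = r * seg_length X Z.
  by move=> r0 ->; rewrite sqrtrM ?sqr_ge0// sqrtr_sqr ger0_norm.
rewrite /seg_length /= (scale t) ?(ltW t0)//; last by ring.
rewrite (scale (1 - t)) ?subr_ge0 ?(ltW t1)//; last by ring.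
by rewrite -mulf_div divff ?mulr1// gt_eqF.
Qed.

Theorem mainTheorem1 (R : realType) (U : set_system nat) (HU : UltraFilter U)
    (U_nonprincipal : nonprincipal U)
    (A B C P Q P' Q' : hyperreal R HU * hyperreal R HU)
    (l p : set (hyperreal R HU * hyperreal R HU))
    (a b c d : hyperreal R HU) :
  ~ collinear A C B ->
  l <> p -> parallel l p ->
  ~ l C -> ~ p C ->
  l P -> ray C A P ->
  l Q -> ray C B Q ->
  p P' -> ray C A P' ->
  p Q' -> ray C B Q' ->
  between C P P' -> between C Q Q' ->
  0 < a -> 0 < b -> 0 < c -> 0 < d ->
  a = seg_length C P -> b = seg_length P P' ->
  c = seg_length C Q -> d = seg_length Q Q' ->
  a / b = c / d.
Proof.
move=> _ _ lp _ pC lP _ lQ _ pP' _ pQ' _.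
move=> [CP' [t [t0 t1 PE]]] [CQ' [s [s0 s1 QE]]] _ _ _ _ -> -> -> ->.
rewrite (seg_length_ratio CP' t0 t1 PE) (seg_length_ratio CQ' s0 s1 QE).
by rewrite (parallel_same_fraction lp pC lP lQ pP' pQ' PE QE).
Qed.
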